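(* Let $0<\alpha<1$ and let $c = 2\pi/e^{1+e^2/2}$. Let $(n_k)$ be a sequence of positive integers such that $n_k = \bigl(c\alpha(1+\varepsilon_k)\bigr)^{1/k}\left(\frac{k}{e}\right)^2 k^{3/(2k)}$ for some sequence $\varepsilon_k \to 0$ as $k\to\infty$. Then for all sufficiently large $k$, at least $(1-\alpha)|\mathcal{T}_{n_k,k}|$ members of $\mathcal{T}_{n_k,k}$ do not have Property O.
   Context: Fix an integer $k \ge 2$ and a finite set $V$. An ordered $k$-set is a $k$-tuple $(x_1,\dots,x_k)$ of distinct elements of $V$. An oriented $k$-graph is a pair $(V,\mathcal{E})$ where $\mathcal{E}\subseteq V^k$ is a family of ordered $k$-sets such that no two members of $\mathcal{E}$ have the same underlying $k$-element set. A $k$-tournament on $V$ is an oriented $k$-graph in which $\mathcal{E}$ contains exactly one ordered $k$-set on each $k$-element subset of $V$ (i.e. each $k$-subset of $V$ is given one of its $k!$ orientations). $\mathcal{T}_{n,k}$ denotes the set of all $k$-tournaments on $[n]=\{1,\dots,n\}$. Given a linear order $<$ on $V$, an ordered $k$-set $(x_1,\dots,x_k)$ is consistent with $<$ if $x_1<\dots<x_k$. An oriented $k$-graph $(V,\mathcal{E})$ has Property O if for every linear order $<$ of $V$ some member of $\mathcal{E}$ is consistent with $<$. *)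

(* Defs.v *)
From HB Require Import structures.
From mathcomp Require Import all_boot all_order all_algebra.
From mathcomp Require Import all_classical all_reals all_analysis.
Import Order.TTheory GRing.Theory Num.Theory.
Import numFieldNormedType.Exports.

Set Implicit Arguments.
Unset Strict Implicit.
Unset Printing Implicit Defensive.

Definition ordered_kset (V : finType) (k : nat) (t : k.-tuple V) : bool :=
  uniq t.

Definition underlying_set (V : finType) (k : nat) (t : k.-tuple V) : {set V} :=
  [set x in t]%SET.

Definition oriented_kgraph (V : finType) (k : nat) (E : {set k.-tuple V}) :
    bool :=
  [forall t in E, ordered_kset t] &&
  [forall s in E, forall t in E,
     (s != t) ==> (underlying_set s != underlying_set t)].

Definition ktournament (V : finType) (k : nat) (E : {set k.-tuple V}) : bool :=
  oriented_kgraph E &&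
  [forall A : {set V}, (#|A| == k) ==>
     (#|[set t in E | underlying_set t == A]%SET| == 1)].

(* The vertex set [n] is represented by 'I_n. *)
Definition ktournaments (n k : nat) : {set {set k.-tuple 'I_n}} :=
  [set E | ktournament E]%SET.

Definition strict_linear_order (V : Type) (lt : rel V) : Prop :=
  [/\ irreflexive lt, transitive lt & forall x y, x <> y -> lt x y \/ lt y x].

(* [sorted lt] is the chain x_1 < x_2, ..., x_(k-1) < x_k. *)
Definition consistent (V : finType) (k : nat) (lt : rel V) (t : k.-tuple V) :
    bool :=
  sorted lt t.

Definition propertyO (V : finType) (k : nat) (E : {set k.-tuple V}) : Prop :=
  forall lt : rel V, strict_linear_order lt ->
    exists2 t, t \in E & consistent lt t.

Local Open Scope ring_scope.

Definition constO (R : realType) : R :=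
  2 * pi / expR (1 + expR 1 ^+ 2 / 2).

(* Main.v *)
(* Order [n] in blocks of logarithmic size.  For a random tournament the expected
   number of edges consistent with this base order is at most polynomial,
   O(k^(5/6)) using only k! >= k^(1/3) (k/e)^k, while n is of order k^2.  A random
   k-set meets every block at most once with probability O(1/k^2), so with high
   probability every base-consistent edge has two vertices in some block;
   choose one such block per edge and reverse the base order inside the chosen
   blocks.  This makes all base-consistent edges inconsistent.  A newly
   consistent edge must have two vertices in one of the O(k^(5/6)) reversed
   blocks; by a switching argument (re-orient that edge in all k! ways) the
   expected number of those is O(k^(5/3) (log k)^2 / k^2) = o(1).  Hence in fact
   almost no tournament has Property O, whatever alpha > 0 is. *)
Require Import Defs.
From HB Require Import structures.
From mathcomp Require Import all_boot all_order all_algebra.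
From mathcomp Require Import all_classical all_reals all_analysis.
From mathcomp Require Import zify ring lra.
Import Order.TTheory GRing.Theory Num.Theory.
Import numFieldNormedType.Exports.

Set Implicit Arguments.
Unset Strict Implicit.
Unset Printing Implicit Defensive.

Local Open Scope nat_scope.

(** Union bound with denominators cleared: in the applications [c] is a power of [k!], so that all
    probability estimates stay inequalities between natural numbers. *)
Lemma card_bigcup_leq (I J : finType) (D : {set I}) (F : I -> {set J})
    (c d : nat) :
  (forall i, i \in D -> #|F i| * c <= d) ->
  #|(\bigcup_(i in D) F i)%SET| * c <= #|D| * d.
Proof.
move=> Fc; rewrite -(sum_nat_const (mem D) d).
apply: (big_ind2 (fun (U : {set J}) s => #|U| * c <= s)) => //.
- by rewrite cards0.
- move=> U s U' s' Us U's'; apply: leq_trans (leq_add Us U's').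
  by rewrite -mulnDl leq_mul2r leq_card_setU orbT.
Qed.

(** * Tournaments and the switching argument *)

Section Tournaments.
Variables (V : finType) (k : nat).
Implicit Types (A : {set V}) (s t : k.-tuple V) (E : {set k.-tuple V}).

Lemma card_underlying_set t : uniq t -> #|underlying_set t| = k.
Proof. by move=> /card_uniqP; rewrite cardsE size_tuple. Qed.

Lemma ktournament_uniq E t : ktournament E -> t \in E -> uniq t.
Proof. by case/andP=> /andP[/'forall_implyP + _] _ => /[apply]. Qed.

Lemma ktournament_inj E s t : ktournament E -> s \in E -> t \in E ->
  underlying_set s = underlying_set t -> s = t.
Proof.
case/andP=> /andP[_ /'forall_implyP E2] _ sE tE st.
have /'forall_implyP/(_ t tE) := E2 s sE.
by rewrite st eqxx implybF negbK => /eqP.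
Qed.

Lemma ktournament_ex E A : ktournament E -> #|A| = k ->
  exists2 t, t \in E & underlying_set t = A.
Proof.
case/andP=> _ /forallP/(_ A)/implyP EA cA; have := EA (introT eqP cA).
case/cards1P => t /finset.setP/(_ t); rewrite !inE eqxx.
by case/andP=> tE /eqP <-; exists t.
Qed.

Lemma ktournamentI E :
  (forall t, t \in E -> uniq t) ->
  (forall s t, s \in E -> t \in E -> underlying_set s = underlying_set t ->
    s = t) ->
  (forall A, #|A| = k -> exists2 t, t \in E & underlying_set t = A) ->
  ktournament E.
Proof.
move=> E1 E2 E3; apply/andP; split; first apply/andP; first split.
- by apply/'forall_implyP => t /E1.
- apply/'forall_implyP => s sE; apply/'forall_implyP => t tE.
  by apply/implyP; apply: contraNN => /eqP /E2 ->.
- apply/forallP => A; apply/implyP => /eqP /E3[t tE tA].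
  apply/cards1P; exists t; apply/finset.setP => s; rewrite !inE.
  apply/andP/eqP => [[sE /eqP sA]|->]; last by rewrite tA eqxx.
  by apply: E2; rewrite // tA.
Qed.

Definition edges_off E A := [set s in E | underlying_set s != A]%SET.

Definition reorient E t := (t |: edges_off E (underlying_set t))%SET.

Lemma edges_off_reorient E t A :
  underlying_set t = A -> edges_off (reorient E t) A = edges_off E A.
Proof.
move=> <-; apply/finset.setP => s; rewrite !inE.
by case: (s =P t) => [->|_]; rewrite ?eqxx ?andbF//= -andbA andbb.
Qed.

Lemma reorient_off E t : ktournament E -> t \in E ->
  t |: edges_off E (underlying_set t) = E.
Proof.
move=> TE tE; apply/finset.setP => s; rewrite !inE.
case: (s =P t) => [->//|/eqP st]; apply/andP/idP => [[]//|sE]; split=> //.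
by apply: contraNN st => /eqP /(ktournament_inj TE sE tE) ->.
Qed.

Lemma reorient_ktournament E t : ktournament E -> uniq t ->
  ktournament (reorient E t).
Proof.
move=> TE ut; apply: ktournamentI.
- by move=> s; rewrite !inE => /orP[/eqP->//|/andP[/(ktournament_uniq TE)]].
- move=> s s'; rewrite !inE => /orP[/eqP->|/andP[sE st]] /orP[/eqP->|/andP[s'E s't]]//.
  + by move=> e; rewrite e eqxx in s't.
  + by move=> e; rewrite e eqxx in st.
  + exact: ktournament_inj TE _ _.
- move=> A cA; have [->|At] := eqVneq A (underlying_set t).
    by exists t; rewrite // finset.setU11.
  have [s sE sA] := ktournament_ex TE cA.
  by exists s; rewrite // !inE sE sA At orbT.
Qed.

Lemma card_orientations A : #|A| = k ->
  #|[set t : k.-tuple V | uniq t & underlying_set t == A]%SET| = k`!.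
Proof.
move=> cA; rewrite -[in RHS]cA -ffactnn -card_uniq_tuples cA.
apply: eq_card => t; rewrite !inE andbC.
case ut: (uniq t); rewrite ?andbF// !andbT.
apply/eqP/allP => [<- x xt|tA]; first by change (x \in underlying_set t); rewrite inE.
(* A repetition-free [k]-tuple inside the [k]-set [A] exhausts it. *)
apply/eqP; rewrite eqEcard cA card_underlying_set// leqnn andbT.
by apply/fintype.subsetP => x; rewrite inE => /tA.
Qed.

(* (E, t) |-> reorient E t embeds Bad x {orientations of A} into Good. *)
Lemma card_reorient A (Bad Good : {set {set k.-tuple V}}) :
  #|A| = k ->
  (forall E, E \in Bad -> forall t, uniq t -> underlying_set t = A ->
    reorient E t \in Good) ->
  {in Bad, forall E, ktournament E} ->
  {in Bad &, forall E E', edges_off E A = edges_off E' A -> E = E'} ->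
  #|Bad| * k`! <= #|Good|.
Proof.
move=> cA BG BT Binj; rewrite -(card_orientations cA) -cardsX.
rewrite -(card_in_imset (f := fun p => reorient p.1 p.2)).
  apply/subset_leq_card/fintype.subsetP => _ /imsetP[[E t] + ->].
  by rewrite !inE => /and3P[EB ut /eqP]; apply: BG.
move=> [E t] [E' t'] /=; rewrite !inE /=.
move=> /and3P[EB ut /eqP tA] /and3P[EB' ut' /eqP tA'] e.
have EE' : E = E'.
  by apply: Binj => //; rewrite -(edges_off_reorient E tA) e edges_off_reorient.
congr (_, _) => //.
have TE : ktournament (reorient E t) by apply: reorient_ktournament; rewrite ?BT.
apply: (ktournament_inj TE); first exact: finset.setU11.
  by rewrite e finset.setU11.
by rewrite tA tA'.
Qed.

(** A prescribed edge occurs with probability at most [1/k!]: switch on the vertex set of [t], where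
    a tournament containing [t] is recovered from its other edges by putting [t] back. *)
Lemma card_star t : uniq t ->
  #|[set E | ktournament E & t \in E]%SET| * k`! <=
  #|[set E : {set k.-tuple V} | ktournament E]%SET|.
Proof.
move=> ut; apply: (card_reorient (card_underlying_set ut)).
- move=> E + s us _; rewrite !inE => /andP[TE _].
  exact: reorient_ktournament.
- by move=> E; rewrite inE => /andP[].
- move=> E E'; rewrite !inE => /andP[TE tE] /andP[TE' tE'] e.
  by rewrite -(reorient_off TE tE) -(reorient_off TE' tE') e.
Qed.

Lemma consistent_inj (lt : rel V) s t : strict_linear_order lt ->
  consistent lt s -> consistent lt t -> underlying_set s = underlying_set t ->
  s = t.
Proof.
case=> irr tr _ ss st e; apply/val_inj/(irr_sorted_eq tr irr ss st) => x.
by have /finset.setP/(_ x) := e; rewrite !inE.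
Qed.

Lemma consistent_uniq (lt : rel V) t : strict_linear_order lt ->
  consistent lt t -> uniq t.
Proof. by case=> irr tr _; apply: sorted_uniq. Qed.

(** A linear order is consistent with at most one orientation of each [k]-set. *)
Lemma card_consistent (lt : rel V) : strict_linear_order lt ->
  #|[set t : k.-tuple V | consistent lt t]%SET| <= 'C(#|V|, k).
Proof.
move=> lin; rewrite -card_draws -(card_in_imset (f := @underlying_set V k)).
  apply/subset_leq_card/fintype.subsetP => _ /imsetP[t + ->]; rewrite !inE => ct.
  by rewrite card_underlying_set// (consistent_uniq lin ct).
by move=> s t; rewrite !inE; apply: consistent_inj.
Qed.

(** Deleting [x] and [y] maps these sets injectively to [(k-2)]-subsets of the complement of the
    pair. *)
Lemma card_draws_doubleton (x y : V) : x != y ->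
  #|[set A : {set V} | [&& #|A| == k, x \in A & y \in A]]%SET|
    <= 'C(#|V|.-2, k.-2).
Proof.
move=> xy; have -> : #|V|.-2 = #|~: [set x; y]%SET|.
  by rewrite cardsCs finset.setCK cards2 xy subn2.
rewrite -cards_draws.
rewrite -(card_in_imset (f := fun A : {set V} => (A :\: [set x; y])%SET)).
  apply/subset_leq_card/fintype.subsetP => _ /imsetP[A + ->].
  rewrite !inE => /and3P[/eqP cA xA yA]; rewrite finset.setDE finset.subsetIr/=.
  rewrite -finset.setDE cardsD (finset.setIidPr _) ?cards2 ?xy ?cA ?subn2//.
  by apply/fintype.subsetP => z; rewrite !inE => /orP[]/eqP->.
move=> A B; rewrite !inE => /and3P[_ xA yA] /and3P[_ xB yB] /finset.setP e.
apply/finset.setP => z; have := e z; rewrite !inE.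
case: (z =P x) => [->|_]; rewrite ?xA ?xB//.
by case: (z =P y) => [->|_]; rewrite ?yA ?yB.
Qed.

End Tournaments.

(** * Orders with reversed blocks, and the count of tournaments with Property O *)

Section BlockOrders.
Variables (V : finType) (k m b : nat) (f : V -> 'I_m) (g : V -> 'I_b).
Hypothesis fg_inj : injective (fun x => (f x, g x)).
Implicit Types (S : {set 'I_m}) (s t : k.-tuple V) (E : {set k.-tuple V}).

(** Here [f] gives the block of a vertex and [g] its position inside the block. The order is
    lexicographic, with the blocks in [S] reversed; [S] empty gives the base order. *)
Definition block_lt S : rel V := fun x y => (f x < f y) ||
  (f x == f y) && (if f x \in S then g y < g x else g x < g y).

Lemma block_lt_linear S : strict_linear_order (block_lt S).
Proof.
split.
- by move=> x; rewrite /block_lt ltnn eqxx /=; case: ifP; rewrite ltnn.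
- move=> y x z /orP[xy|/andP[/eqP xy gxy]] /orP[yz|/andP[/eqP yz gyz]];
    rewrite /block_lt.
  + by rewrite (ltn_trans xy yz).
  + by rewrite -yz xy.
  + by rewrite xy yz.
  + rewrite xy yz eqxx ltnn /=; move: gxy gyz; rewrite xy yz.
    by case: ifP => _ p q; [apply: ltn_trans q p | apply: ltn_trans p q].
- move=> x y xy; rewrite /block_lt; case: (ltngtP (f x) (f y)) => [||/val_inj fxy].
  + by left.
  + by right.
  rewrite fxy eqxx /=; have : g x != g y.
    by apply: contra_notN xy => /eqP gxy; apply: fg_inj; rewrite fxy gxy.
  by rewrite -val_eqE neq_ltn; case: ifP => _ /orP[]; auto.
Qed.

Let base := block_lt finset.set0.

Definition doubled (A : {set V}) (c : 'I_m) :=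
  1 < #|[set x in A | f x == c]%SET|.

Lemma doubledP (A : {set V}) (c : 'I_m) :
  reflect (exists x y, [/\ x \in A, y \in A, x != y, f x = c & f y = c])
    (doubled A c).
Proof.
apply: (iffP card_gt1P) => [[x [y []]]|[x [y [xA yA xy fx fy]]]].
  by rewrite !inE => /andP[xA /eqP fx] /andP[yA /eqP fy] xy; exists x, y.
by exists x, y; rewrite !inE xA yA fx fy eqxx.
Qed.

(** The two orders disagree only on pairs lying in a common block of [S], and [t] contains no such
    pair. *)
Lemma consistent_base S t :
  (forall c, doubled (underlying_set t) c -> c \notin S) ->
  consistent (block_lt S) t -> consistent base t.
Proof.
move=> noS; apply: (sub_in_sorted (P := mem t)); last exact/allP.
move=> x y xt yt xy; rewrite /base /block_lt; move: (xy).
rewrite /block_lt -!val_eqE /=; case: ltngtP => //= /val_inj fxy.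
rewrite finset.in_set0.
rewrite ifN//; apply: noS; apply/doubledP; exists x, y.
rewrite !inE; split => //; apply: contraTneq xy => ->.
by have [-> _ _] := block_lt_linear S.
Qed.

(** Two vertices of [t] in the reversed block [c] are compared in opposite ways by the two orders,
    so [t] cannot be increasing for both. *)
Lemma not_consistent_flip S t c : consistent base t ->
  doubled (underlying_set t) c -> c \in S -> ~~ consistent (block_lt S) t.
Proof.
move=> ct /doubledP[x [y []]]; rewrite !inE => xt yt xy fx fy cS.
apply/negP => cSt.
have [_ tr0 _] := block_lt_linear finset.set0; have [_ trS _] := block_lt_linear S.
wlog ixy : x y xt yt xy fx fy / index x t < index y t.
  have : index x t != index y t.
    by apply: contraNN xy => /eqP e; rewrite -(nth_index x xt) e nth_index.
  by rewrite neq_ltn => /orP[]i H; [apply: (H x y)|apply: (H y x)]; rewrite // eq_sym.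
have := sorted_ltn_index tr0 ct _ _ xt yt ixy.
have := sorted_ltn_index trS cSt _ _ xt yt ixy.
rewrite /block_lt fx fy ltnn eqxx cS finset.in_set0 /= => p q.
by have := ltn_trans p q; rewrite ltnn.
Qed.

(** The choice depends on [t] alone, not on a tournament containing it. It is [None] exactly when
    the vertices of [t] lie in distinct blocks, and then no reversal can destroy [t]. *)
Definition chosen_block t := [pick c | doubled (underlying_set t) c].

Definition flipped E := [set c | [exists t in E,
  consistent base t && (chosen_block t == Some c)]]%SET.

Definition rainbow_edges :=
  [set t : k.-tuple V | consistent base t & chosen_block t == None]%SET.

(** The vertex sets on which reversing the block chosen for [s] can create a consistent edge. The
    default [false] makes this empty when [s] has no chosen block. *)
Definition clashing_sets s := [set A : {set V} | [&& #|A| == k,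
  A != underlying_set s & oapp (doubled A) false (chosen_block s)]]%SET.

(** Requiring the edge on [A] not to be base-consistent ensures that this edge has no influence on
    [flipped E]. *)
Definition clash s (A : {set V}) : {set {set k.-tuple V}} :=
  [set E | [&& ktournament E, s \in E & [exists t in E,
    [&& underlying_set t == A, ~~ consistent base t &
      consistent (block_lt (flipped E)) t]]]]%SET.

(** Test Property O on the order obtained by reversing [flipped E]. A consistent edge that is also
    base-consistent must be rainbow, since otherwise its chosen block was reversed. Any other one
    has two vertices in a block reversed on account of some edge [s]. *)
Lemma propertyO_cover E : ktournament E -> propertyO E ->
  (exists2 t, t \in rainbow_edges & t \in E) \/
  exists2 s, consistent base s & exists2 A, A \in clashing_sets s & E \in clash s A.
Proof.
move=> TE /(_ _ (block_lt_linear (flipped E)))[t tE ct].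
have [bt|nbt] := boolP (consistent base t).
  left; exists t => //; rewrite inE bt; apply/eqP.
  rewrite /chosen_block; case: pickP => // c dc.
  have [d e dd] : exists2 d, chosen_block t = Some d & doubled (underlying_set t) d.
    rewrite /chosen_block; case: pickP => [d ? | /(_ c)]; first by exists d.
    by rewrite dc.
  have dF : d \in flipped E.
    by rewrite inE; apply/'exists_andP; exists t; rewrite tE bt e eqxx.
  by have := not_consistent_flip bt dd dF; rewrite ct.
right.
have [c dc cF] : exists2 c, doubled (underlying_set t) c & c \in flipped E.
  apply: contrapT => noc; move/negP: nbt; apply.
  apply: consistent_base ct => c dc; apply/negP => cF; apply: noc; by exists c.
move: (cF); rewrite inE => /'exists_andP[s [sE /andP[bs /eqP sc]]].
exists s => //; exists (underlying_set t); last first.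
  rewrite inE TE sE; apply/'exists_andP; exists t; split => //.
  by rewrite eqxx nbt.
rewrite inE sc /= dc andbT card_underlying_set ?(ktournament_uniq TE)// eqxx /=.
by apply: contraNneq nbt => /(ktournament_inj TE tE sE) ->.
Qed.

(** Along a rainbow base-consistent edge the block index increases strictly, so the set of blocks
    met and the tuple of positions determine the edge. *)
Lemma card_rainbow_edges : #|rainbow_edges| <= 'C(m, k) * b ^ k.
Proof.
have lin := block_lt_linear finset.set0.
have frb t : t \in rainbow_edges -> {in t &, injective f}.
  rewrite inE => /andP[_]; rewrite /chosen_block; case: pickP => // nod _.
  move=> x y xt yt fxy; apply/eqP; apply: contraFT (nod (f x)) => xy.
  by apply/doubledP; exists x, y; rewrite !inE.
pose h t := ([set f x | x in underlying_set t]%SET, map_tuple g t).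
have -> : 'C(m, k) * b ^ k =
    #|finset.setX [set A : {set 'I_m} | #|A| == k]%SET [set: k.-tuple 'I_b]%SET|.
  by rewrite cardsX card_draws card_ord cardsT card_tuple card_ord.
rewrite -(card_in_imset (f := h)).
  apply/subset_leq_card/fintype.subsetP => _ /imsetP[t tR ->].
  rewrite !inE andbT card_in_imset.
    apply/eqP/card_underlying_set.
    by move: tR; rewrite inE => /andP[/(consistent_uniq lin)].
  by move=> x y; rewrite !inE; apply: frb.
have fsorted t : t \in rainbow_edges -> sorted (fun i j : 'I_m => i < j) (map f t).
  move=> tR; have := tR; rewrite inE => /andP[bt _].
  rewrite sorted_map; apply: (sub_in_sorted (P := mem t)) bt; last exact/allP.
  move=> x y xt yt; rewrite /base /block_lt -val_eqE /=.
  case: ltngtP => //= /val_inj fxy; rewrite (frb t tR x y xt yt fxy) finset.in_set0.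
  by rewrite ltnn.
move=> s t sR tR [/finset.setP fst gst]; apply: val_inj.
have fe : map f s = map f t.
  apply: (@irr_sorted_eq _ (fun i j : 'I_m => i < j)).
  - by move=> ? ? ?; apply: ltn_trans.
  - by move=> ?; rewrite ltnn.
  - exact: fsorted.
  - exact: fsorted.
  have im (u : k.-tuple V) : (map f u =i [set f x | x in underlying_set u]%SET).
    move=> c; apply/mapP/imsetP => -[x xu ->]; exists x => //;
    by rewrite inE in xu *.
  by move=> c; rewrite !im fst.
have /(congr1 (fun p => zip p.1 p.2)) /= : (map f s, map g s) = (map f t, map g t).
  by rewrite fe gst.
by rewrite !zip_map => /(inj_map fg_inj).
Qed.

(** Sum over the pairs of distinct vertices in the chosen block; as [g] is injective on a block,
    there are at most [b^2] of them. *)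
Lemma card_clashing_sets s : #|clashing_sets s| <= b ^ 2 * 'C(#|V|.-2, k.-2).
Proof.
case cs : (chosen_block s) => [c|]; last first.
  by rewrite (eq_card0 (A := clashing_sets s))// => A; rewrite !inE cs !andbF.
pose P := [set p : V * V | [&& f p.1 == c, f p.2 == c & p.1 != p.2]]%SET.
pose F (p : V * V) := [set A : {set V} | [&& #|A| == k, p.1 \in A & p.2 \in A]]%SET.
have sub : clashing_sets s \subset (\bigcup_(p in P) F p)%SET.
  apply/fintype.subsetP => A; rewrite inE cs /= => /and3P[cA _].
  move=> /doubledP[x [y [xA yA xy fx fy]]].
  by apply/bigcupP; exists (x, y); rewrite !inE /= ?cA ?xA ?yA ?fx ?fy ?eqxx.
apply: leq_trans (subset_leq_card sub) _.
have := @card_bigcup_leq _ _ P F 1 'C(#|V|.-2, k.-2); rewrite muln1.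
move=> /(_ _)/leq_trans; apply.
  by move=> [x y]; rewrite inE /= muln1 => /and3P[_ _]; apply: card_draws_doubleton.
rewrite leq_mul2r; apply/orP; right.
have -> : b ^ 2 = #|[set: 'I_b * 'I_b]%SET| by rewrite cardsT card_prod card_ord.
rewrite -(card_in_imset (f := fun p : V * V => (g p.1, g p.2))).
  exact/subset_leq_card/finset.subsetT.
move=> [x y] [x' y']; rewrite !inE /= => /and3P[/eqP fx /eqP fy _].
move=> /and3P[/eqP fx' /eqP fy' _] [gx gy].
by congr (_, _); apply: fg_inj; congr (_, _) => //; rewrite ?fx ?fy.
Qed.

(* The flipped blocks are determined by the base-consistent edges, hence do not
   depend on the edge on A; so once all other edges are fixed, at most one of
   the k! orientations of A produces a clash. *)
Lemma card_clash s A : uniq s -> A \in clashing_sets s ->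
  #|clash s A| * k`! ^ 2 <= #|[set E : {set k.-tuple V} | ktournament E]%SET|.
Proof.
move=> us; rewrite inE => /and3P[/eqP cA As _].
(* One factor [k!] pays for the presence of [s], the other for the orientation on [A]. *)
apply: leq_trans (card_star us); rewrite expnS expn1 mulnA leq_mul2r.
apply/orP; right; apply: (card_reorient cA).
- move=> E + t ut tA; rewrite !inE => /and3P[TE sE _].
  by rewrite reorient_ktournament// sE tA [_ == A]eq_sym As orbT.
- by move=> E; rewrite inE => /and3P[].
have off_flip E t : ktournament E -> t \in E -> underlying_set t = A ->
    ~~ consistent base t -> flipped E = flipped (edges_off E A).
  move=> TE tE tA nbt; apply/finset.setP => c; rewrite !inE.
  apply/'exists_andP/'exists_andP => -[r [rE /andP[br rc]]]; exists r.
    split; last by rewrite br.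
    rewrite inE rE -tA; apply: contraNneq nbt => /(ktournament_inj TE rE tE) <-.
    exact: br.
  by move: rE; rewrite inE => /andP[rE _]; rewrite br.
move=> E E'; rewrite !inE.
move=> /and3P[TE _ /'exists_andP[t [tE /and3P[/eqP tA nbt ct]]]].
move=> /and3P[TE' _ /'exists_andP[t' [t'E' /and3P[/eqP t'A nbt' ct']]]] e.
have ff : flipped E = flipped E'.
  by rewrite (off_flip E t)// (off_flip E' t')// e.
rewrite -(reorient_off TE tE) -(reorient_off TE' t'E') tA t'A e.
congr (_ |: _)%SET; apply: (consistent_inj (block_lt_linear _) ct).
  by rewrite ff.
by rewrite tA.
Qed.

(** Union bound over the two cases of [propertyO_cover], cleared by [k!^2]: a rainbow edge has
    probability at most [1/k!], a clash at most [1/k!^2]. *)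
Lemma card_propertyO :
  #|[set E : {set k.-tuple V} | ktournament E & `[< propertyO E >]]%SET| * k`! ^ 2
  <= #|[set E : {set k.-tuple V} | ktournament E]%SET| *
     (k`! * ('C(m, k) * b ^ k) + 'C(#|V|, k) * (b ^ 2 * 'C(#|V|.-2, k.-2))).
Proof.
set T := #|[set E : {set k.-tuple V} | ktournament E]%SET|.
pose B1 := (\bigcup_(t in rainbow_edges) [set E | ktournament E & t \in E])%SET.
pose B2 := (\bigcup_(s in [set s : k.-tuple V | consistent base s])
  \bigcup_(A in clashing_sets s) clash s A)%SET.
have sub : [set E : {set k.-tuple V} | ktournament E & `[< propertyO E >]]%SET
    \subset (B1 :|: B2)%SET.
  apply/fintype.subsetP => E; rewrite inE => /andP[TE /asboolP].
  move=> /(propertyO_cover TE)[[t tR tE]|[s bs [A As EA]]]; rewrite inE.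
    by apply/orP; left; apply/bigcupP; exists t; rewrite // inE TE.
  apply/orP; right; apply/bigcupP; exists s; rewrite ?inE//.
  by apply/bigcupP; exists A.
have lin := block_lt_linear finset.set0.
have B1c : #|B1| * k`! <= 'C(m, k) * b ^ k * T.
  apply: leq_trans (leq_mul card_rainbow_edges (leqnn T)).
  apply: card_bigcup_leq => t; rewrite inE => /andP[/(consistent_uniq lin) ut _].
  exact: card_star.
have B2c : #|B2| * k`! ^ 2 <= 'C(#|V|, k) * (b ^ 2 * 'C(#|V|.-2, k.-2) * T).
  apply: leq_trans (leq_mul (card_consistent k lin) (leqnn _)).
  apply: card_bigcup_leq => s; rewrite inE => /(consistent_uniq lin) us.
  apply: leq_trans (leq_mul (card_clashing_sets s) (leqnn T)).
  by apply: card_bigcup_leq => A; apply: card_clash.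
apply: (@leq_trans ((#|B1| + #|B2|) * k`! ^ 2)).
  rewrite leq_mul2r (leq_trans (subset_leq_card sub)) ?orbT//.
  exact: leq_card_setU.
rewrite mulnDl mulnDr leq_add//.
  rewrite expnS expn1 mulnA mulnC [T * _]mulnC -mulnA leq_mul2l.
  by rewrite B1c orbT.
by rewrite [T * _]mulnC -[_ * T]mulnA.
Qed.

End BlockOrders.

(** * Analytic estimates *)

Section Estimates.
Variable R : realType.
Local Open Scope classical_set_scope.
Local Open Scope ring_scope.

(** The left side is a partial sum of the exponential series, whose terms are nonnegative. *)
Lemma expR_ge1DxDx2 (x : R) : 0 <= x -> 1 + x + x ^+ 2 / 2 <= expR x.
Proof.
move=> x0; have -> : 1 + x + x ^+ 2 / 2 = series (exp_coeff x) 3.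
  rewrite /series /= !big_nat_recr //= big_geq// /exp_coeff /=.
  by rewrite expr0 expr1 !divr1 add0r.
apply: nondecreasing_cvgn_le; last exact: is_cvg_series_exp_coeff.
exact: nondecreasing_series (fun n _ _ => exp_coeff_ge0 n x0).
Qed.

Lemma expR_ge_expn (x : R) (j : nat) : (0 < j)%N -> 0 <= x ->
  (x / j%:R) ^+ j <= expR x.
Proof.
move=> j0 x0; have -> : expR x = expR (x / j%:R) ^+ j.
  by rewrite -expRM_natr divfK// pnatr_eq0 -lt0n.
apply: lerXn2r; rewrite ?nnegrE ?expR_ge0 ?divr_ge0//.
by apply: le_trans (expR_ge1Dx _); rewrite lerDr.
Qed.

(* A weak form of Stirling's lower bound, k! >= k^(1/3) (k/e)^k. *)
Lemma fact_cube_ge (k : nat) : (0 < k)%N ->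
  k%:R ^+ (3 * k + 1) <= expR 1 ^+ (3 * k) * k`!%:R ^+ 3 :> R.
Proof.
elim: k => // -[_ _|k IH _].
  rewrite expr1n expr1n mulr1 exprn_ege1// -expR0 ler_expR//.
set l := k.+1 in IH *; have {}IH := IH isT.
have l0 : 0 < l%:R :> R by rewrite ltr0n.
(* This is [(1 + 1/l)^(3l+1) <= e^3]. Taking roots, it becomes [1 + 1/l <= e^u] with [u = 3/(3l+1)],
   which follows from the quadratic Taylor bound. *)
have step : l.+1%:R ^+ (3 * l + 1) <= expR 1 ^+ 3 * l%:R ^+ (3 * l + 1) :> R.
  set u : R := 3 / (3 * l + 1)%:R.
  have -> : expR 1 ^+ 3 = expR u ^+ (3 * l + 1) :> R.
    by rewrite -!expRM_natl mulr1 /u [in RHS]mulrC divfK// pnatr_eq0 addn1.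
  rewrite -exprMn; apply: lerXn2r; rewrite ?nnegrE ?mulr_ge0 ?expR_ge0//.
  have u0 : 0 <= u by rewrite divr_ge0.
  apply: le_trans (ler_wpM2r (ltW l0) (expR_ge1DxDx2 u0)).
  have d0 : 0 < (3 * l + 1)%:R :> R by rewrite ltr0n addn1.
  have l1 : 1 <= l%:R :> R by rewrite ler1n.
  rewrite /u -subr_ge0.
  have -> : (1 + 3 / (3 * l + 1)%:R + (3 / (3 * l + 1)%:R) ^+ 2 / 2) * l%:R - l.+1%:R
     = (3 * l%:R - 2) / (2 * (3 * l + 1)%:R ^+ 2) :> R.
    rewrite -natr1 natrD natrM in d0 *; field; lra.
  by rewrite divr_ge0 ?mulr_ge0 ?exprn_ge0 ?ltW//; lra.
rewrite factS natrM exprMn.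
have -> : (3 * l.+1 + 1 = 3 + (3 * l + 1))%N by lia.
have -> : (3 * l.+1 = 3 + 3 * l)%N by lia.
rewrite [l.+1%:R ^+ (3 + _)]exprD [expR 1 ^+ (3 + _)]exprD; set x := l.+1%:R ^+ 3.
have x0 : 0 <= x :> R by rewrite exprn_ge0.
apply: le_trans (ler_wpM2l x0 step) _.
have e0 : 0 <= expR 1 ^+ 3 :> R by rewrite exprn_ge0// expR_ge0.
apply: le_trans (ler_wpM2l x0 (ler_wpM2l e0 IH)) _.
by rewrite le_eqVlt; apply/orP; left; apply/eqP; ring.
Qed.

(** Multiply the bounds [1 - i/m <= exp(-i/m)] for [i < k]. *)
Lemma ffact_le_expR (m k : nat) : (0 < m)%N ->
  (m ^_ k)%:R <= m%:R ^+ k * expR (- (k%:R * (k%:R - 1) / (2 * m%:R))) :> R.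
Proof.
move=> m0; have m0' : 0 < m%:R :> R by rewrite ltr0n.
elim: k => [|k IH]; first by rewrite ffactn0 expr0 mul0r mul0r oppr0 expR0 mulr1.
rewrite ffactnSr natrM exprSr.
have -> : - (k.+1%:R * (k.+1%:R - 1) / (2 * m%:R)) =
   - (k%:R * (k%:R - 1) / (2 * m%:R)) + - (k%:R / m%:R) :> R.
  by rewrite -natr1; field; rewrite gt_eqF.
rewrite expRD mulrACA ler_pM//.
(* For [m < k] the truncated difference [m - k] is [0], so the new factor vanishes. *)
have [km|mk] := leqP k m; last first.
  by rewrite (eqP (ltnW mk : m - k == 0)%N) mulr_ge0 ?expR_ge0// ltW.
rewrite natrB// -[leLHS](mulfVK (lt0r_neq0 m0')) mulrC ler_pM2l//.
rewrite mulrBl divff ?gt_eqF//; exact: expR_ge1Dx.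
Qed.

(** The ratio [N^k / k!^2] bounds the expected number of base-consistent edges. It is at most
    [K k^(3/2 - 2/3) = K k^(5/6)]; sixth powers avoid fractional exponents. *)
Lemma expn_div_fact_sq_le (K : R) (N k : nat) : (0 < k)%N ->
  N%:R ^+ (2 * k) * expR 1 ^+ (4 * k) <= K ^+ 2 * k%:R ^+ (4 * k + 3) ->
  (N%:R ^+ k / k`!%:R ^+ 2) ^+ 6 <= K ^+ 6 * k%:R ^+ 5.
Proof.
move=> k0 hN; have F0 : 0 < k`!%:R :> R by rewrite ltr0n fact_gt0.
have e0 : 0 < expR 1 :> R := expR_gt0 1.
rewrite expr_div_n ler_pdivrMr ?exprn_gt0//.
rewrite -(ler_pM2r (exprn_gt0 (12 * k) e0)).
have hN3 : N%:R ^+ (6 * k) * expR 1 ^+ (12 * k) <= K ^+ 6 * k%:R ^+ (12 * k + 9) :> R.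
  have -> : (6 * k = 2 * k * 3)%N by lia.
  have -> : (12 * k = 4 * k * 3)%N by lia.
  have -> : (4 * k * 3 + 9 = (4 * k + 3) * 3)%N by lia.
  rewrite (exprM K 2 3) !(exprM _ _ 3) -!exprMn; apply: lerXn2r hN;
    by rewrite nnegrE mulr_ge0 ?sqr_ge0 ?exprn_ge0// ltW.
have hF : k%:R ^+ (12 * k + 4) <= expR 1 ^+ (12 * k) * k`!%:R ^+ 12 :> R.
  have -> : (12 * k = 3 * k * 4)%N by lia.
  have -> : (3 * k * 4 + 4 = (3 * k + 1) * 4)%N by lia.
  rewrite (exprM k`!%:R 3 4) !(exprM _ _ 4) -exprMn.
  by apply: lerXn2r (fact_cube_ge k0); rewrite nnegrE ?mulr_ge0 ?exprn_ge0// ltW.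
rewrite -!exprM (mulnC k); apply: le_trans hN3 _.
have -> : (12 * k + 9 = 5 + (12 * k + 4))%N by lia.
rewrite [k%:R ^+ (5 + _)]exprD mulrA -[leRHS]mulrA.
apply: ler_wpM2l; last by rewrite mulrC.
by rewrite mulr_ge0 ?(exprn_ge0 5)// (exprM K 2 3) exprn_ge0// sqr_ge0.
Qed.

(** Fixing two vertices gains a factor [(k/N)^2], which is at most [c^2/k^2] because
    [k^2/N <= c]. *)
Lemma bin_mul_bin_le (c : R) (N k : nat) : (2 <= k)%N ->
  k%:R ^+ 2 <= c * N%:R ->
  ('C(N, k) * 'C(N.-2, k.-2))%:R
    <= c ^+ 2 / k%:R ^+ 2 * (N%:R ^+ k / k`!%:R ^+ 2) ^+ 2 * k`!%:R ^+ 2 :> R.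
Proof.
move=> k2 hk; have F0 : 0 < k`!%:R :> R by rewrite ltr0n fact_gt0.
have k0 : 0 < k%:R :> R by rewrite ltr0n; lia.
have cN0 : 0 <= c * N%:R by apply: le_trans hk; exact: sqr_ge0.
have ffle n j : (n ^_ j <= n ^ j)%N.
  by elim: j => // j IH; rewrite ffactnSr expnSr leq_mul ?leq_subr.
have h1 : 'C(N, k)%:R * k`!%:R <= N%:R ^+ k :> R.
  by rewrite -natrM bin_ffact -natrX ler_nat.
have h2 : N%:R ^+ 2 * 'C(N.-2, k.-2)%:R * k`!%:R <= k%:R ^+ 2 * N%:R ^+ k :> R.
  rewrite -!natrX -!natrM ler_nat.
  have [j ->] : exists j, k = j.+2 by exists k.-2; lia.
  have -> : j.+2`! = j.+2 * j.+1 * j`! by rewrite !factS mulnA.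
  have -> : (N ^ 2 * 'C(N.-2, j.+2.-2) * (j.+2 * j.+1 * j`!) =
    (j.+2 * j.+1) * (N ^ 2 * ('C(N.-2, j) * j`!)))%N by rewrite /=; ring.
  rewrite bin_ffact -[in leqRHS]addn2 expnD leq_mul//; first nia.
  rewrite [leqRHS]mulnC leq_mul2l; apply/orP; right.
  apply: leq_trans (ffle _ _) _; case: (j) => // i; rewrite leq_exp2r//; lia.
have h3 : (k%:R ^+ 2) ^+ 2 <= (c * N%:R) ^+ 2.
  by apply: lerXn2r; rewrite ?nnegrE// sqr_ge0.
set F := k`!%:R in F0 h1 h2 *; set x := 'C(N, k)%:R in h1 *.
set y := 'C(_, _)%:R in h2 *; set D := N%:R ^+ k in h1 h2 *.
have x0 : 0 <= x by rewrite ler0n.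
have y0 : 0 <= y by rewrite ler0n.
have -> : c ^+ 2 / k%:R ^+ 2 * (D / F ^+ 2) ^+ 2 * F ^+ 2 =
  c ^+ 2 * D ^+ 2 / (k%:R ^+ 2 * F ^+ 2).
  by field; rewrite !gt_eqF.
rewrite natrM -/x -/y ler_pdivlMr ?mulr_gt0 ?exprn_gt0//.
rewrite -(ler_pM2r (exprn_gt0 2 k0)).
have -> : x * y * (k%:R ^+ 2 * F ^+ 2) * k%:R ^+ 2 =
   (k%:R ^+ 2) ^+ 2 * (x * F * (y * F)) by ring.
apply: le_trans (ler_wpM2r _ h3) _; first by rewrite !mulr_ge0// ltW.
have -> : (c * N%:R) ^+ 2 * (x * F * (y * F)) =
  c ^+ 2 * ((x * F) * (N%:R ^+ 2 * y * F)) by ring.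
have -> : c ^+ 2 * D ^+ 2 * k%:R ^+ 2 = c ^+ 2 * (D * (k%:R ^+ 2 * D)) by ring.
by rewrite ler_wpM2l ?sqr_ge0// ler_pM// ?mulr_ge0 ?sqr_ge0// ltW.
Qed.

(** With [m] blocks the left side is [m^_k b^k], at most [(mb)^k exp(-k(k-1)/(2m))]. Rounding up the
    number of blocks costs at most [exp(kb/N)], since [mb <= N + b]. *)
Lemma rainbow_bound (c : R) (N k b : nat) :
  (0 < b)%N -> (0 < N)%N -> (2 * N <= k ^ 2)%N -> (2 * b <= k ^ 2)%N ->
  k%:R ^+ 2 <= c * N%:R -> 4 * c + 2 <= k%:R ->
  (k`! * ('C((N %/ b).+1, k) * b ^ k))%:R <= N%:R ^+ k * expR (- (b%:R / 4)) :> R.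
Proof.
move=> b0 N0 hN hb hk hc; set m := (N %/ b).+1.
have k1 : (0 < k)%N by case: k hN {hb hk hc} => //; lia.
have k0 : 0 < k%:R :> R by rewrite ltr0n.
have m0 : 0 < m%:R :> R by rewrite ltr0n.
have b0' : 0 < b%:R :> R by rewrite ltr0n.
have N0' : 0 < N%:R :> R by rewrite ltr0n.
have mb : (m * b <= N + b)%N by rewrite /m mulSn addnC leq_add2r leq_divM.
have mbk : m%:R * b%:R <= k%:R ^+ 2 :> R.
  by rewrite -natrX -natrM ler_nat; lia.
have -> : (k`! * ('C(m, k) * b ^ k) = m ^_ k * b ^ k)%N.
  by rewrite -bin_ffact; ring.
rewrite natrM natrX; apply: le_trans (ler_wpM2r _ (ffact_le_expR k _)) _ => //.
rewrite mulrAC -exprMn.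
have : (m%:R * b%:R) ^+ k <= N%:R ^+ k * expR (k%:R * (b%:R / N%:R)) :> R.
  rewrite expRM_natl -exprMn; apply: lerXn2r; rewrite ?nnegrE.
  - by rewrite mulr_ge0.
  - by rewrite mulr_ge0 ?expR_ge0.
  apply: le_trans (ler_wpM2l (ltW N0') (expR_ge1Dx _)).
  rewrite mulrDr mulr1 mulrCA divff ?gt_eqF// mulr1.
  by rewrite -natrM -natrD ler_nat.
move/(ler_wpM2r (expR_ge0 (- (k%:R * (k%:R - 1) / (2 * m%:R))))) => /le_trans; apply.
rewrite -[leLHS]mulrA -expRD ler_wpM2l ?exprn_ge0// ler_expR.
have h1 : k%:R * (b%:R / N%:R) <= c * b%:R / k%:R :> R.
  rewrite mulrA ler_pdivrMr// mulrAC ler_pdivlMr//; nra.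
have h2 : b%:R * (k%:R - 1) / (2 * k%:R) <= k%:R * (k%:R - 1) / (2 * m%:R) :> R.
  have k11 : 0 <= k%:R - 1 :> R by rewrite subr_ge0 ler1n.
  rewrite ler_pdivrMr ?mulr_gt0// mulrAC ler_pdivlMr ?mulr_gt0//.
  have := ler_wpM2r k11 mbk; nra.
(* After clearing denominators this is exactly [4c + 2 <= k]. *)
have h3 : c * b%:R / k%:R - b%:R * (k%:R - 1) / (2 * k%:R) <= - (b%:R / 4) :> R.
  have -> : c * b%:R / k%:R - b%:R * (k%:R - 1) / (2 * k%:R) =
    b%:R * (2 * c - k%:R + 1) / (2 * k%:R) :> R by field; rewrite gt_eqF.
  rewrite ler_pdivrMr ?mulr_gt0//; nra.
lra.
Qed.

(** From [k >= 2^L = exp(L ln 2) >= (L ln 2 / 7)^7]. The clash estimate needs [L^6 = o(k)], hence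
    one power more here. *)
Lemma expn_trunc_log_le : exists2 q : R, 0 < q &
  forall k : nat, (0 < k)%N -> q * (trunc_log 2 k)%:R ^+ 7 <= k%:R.
Proof.
have ln2 : 0 < ln 2 :> R by rewrite ln_gt0// ltr1n.
exists ((ln 2 / 7) ^+ 7); first by rewrite exprn_gt0 ?divr_gt0.
move=> k k0; set L := trunc_log 2 k.
have : (2 ^ L)%:R <= k%:R :> R by rewrite ler_nat trunc_logP.
apply: le_trans; rewrite natrX -[2%:R in leRHS](@lnK R) ?posrE// -expRM_natr.
apply: le_trans (expR_ge_expn (isT : (0 < 7)%N) _); last by rewrite mulr_ge0// ltW.
by rewrite -exprMn mulrAC.
Qed.

Lemma bad_weight_small (K c d : R) : 0 < K -> 0 <= c -> 0 < d ->
  \forall k \near \oo, forall N : nat,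
    (0 < N)%N -> (2 * N <= k ^ 2)%N -> k%:R ^+ 2 <= c * N%:R ->
    N%:R ^+ (2 * k) * expR 1 ^+ (4 * k) <= K ^+ 2 * k%:R ^+ (4 * k + 3) ->
    exists m b : nat, (N <= m * b)%N /\
      (k`! * ('C(m, k) * b ^ k) + 'C(N, k) * (b ^ 2 * 'C(N.-2, k.-2)))%:R
        <= d * k`!%:R ^+ 2.
Proof.
move=> K0 c0 d0; have [q q0 hq] := expn_trunc_log_le.
(* The clash term will be at most [64 c^2 th], so this makes it at most [d/2]. *)
have [th th0 thd] : exists2 th : R, 0 < th & 128 * c ^+ 2 * th <= d.
  have cc0 : 0 < 128 * c ^+ 2 + 1 by rewrite ltr_wpDl// mulr_ge0// sqr_ge0.
  exists (d / (128 * c ^+ 2 + 1)); first exact: divr_gt0.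
  by rewrite mulrA ler_pdivrMr//; nra.
(* Once [L >= r], one has [K^6 L^6 <= th^3 q L^7 <= th^3 k]. *)
pose r := K ^+ 6 / (th ^+ 3 * q).
have r0 : 0 <= r.
  exact: divr_ge0 (exprn_ge0 _ (ltW K0)) (mulr_ge0 (exprn_ge0 _ (ltW th0)) (ltW q0)).
near=> k => N N0 hN hk hNk.
have k16 : (16 <= k)%N by near: k; exact: nbhs_infty_ge.
have kc : 4 * c + 2 <= k%:R by near: k; exact: nbhs_infty_ger.
have kK : 8 * K / d <= k%:R by near: k; exact: nbhs_infty_ger.
set L := trunc_log 2 k.
have rL : r <= L%:R.
  have : (2 ^ Num.bound r <= k)%N by near: k; exact: nbhs_infty_ge.
  move=> /(trunc_log_max (isT : (1 < 2)%N)); rewrite -(ler_nat R).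
  by apply: le_trans; apply/ltW/archi_boundP.
have k0n : (0 < k)%N by exact: leq_trans k16.
have L0 : (0 < L)%N by rewrite trunc_log_gt0 /=; exact: leq_trans k16.
have Lk : (L <= k)%N.
  by apply: leq_trans (trunc_logP (isT : (1 < 2)%N) k0n); rewrite ltnW// ltn_expl.
have k0 : 0 < k%:R :> R by rewrite ltr0n.
have F0 : 0 < k`!%:R :> R by rewrite ltr0n fact_gt0.
have hA6 := expn_div_fact_sq_le k0n hNk.
set A := N%:R ^+ k / k`!%:R ^+ 2 in hA6.
have A0 : 0 <= A by rewrite divr_ge0 ?exprn_ge0.
have eA : N%:R ^+ k = A * k`!%:R ^+ 2.
  by rewrite /A divfK// expf_neq0// gt_eqF.
have hbin := bin_mul_bin_le (leq_trans (isT : (2 <= 16)%N) k16) hk.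
rewrite -/A in hbin; clearbody A.
(* Block size [8L] turns [exp(-b/4)] into [exp(-2L) <= 4/k^2], which beats the crude bound
   [A <= K k]. *)
exists (N %/ (8 * L)).+1, (8 * L)%N; split.
  by rewrite mulSn addnC {1}(divn_eq N (8 * L)) leq_add2l ltnW// ltn_mod muln_gt0.
have AK : A <= K * k%:R.
  rewrite -(ler_pXn2r (isT : (0 < 6)%N)) ?nnegrE ?mulr_ge0 ?(ltW K0)//.
  apply: le_trans hA6 _; rewrite exprMn ler_wpM2l ?exprn_ge0 ?(ltW K0)//.
  by rewrite ler_eXn2l// ltr1n; exact: leq_trans k16.
have AL : A ^+ 2 * L%:R ^+ 2 <= th * k%:R ^+ 2.
  rewrite -(ler_pXn2r (isT : (0 < 3)%N)) ?nnegrE ?mulr_ge0 ?exprn_ge0 ?(ltW th0)//.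
  have -> : (A ^+ 2 * L%:R ^+ 2) ^+ 3 = A ^+ 6 * L%:R ^+ 6 by ring.
  have -> : (th * k%:R ^+ 2) ^+ 3 = k%:R ^+ 5 * (th ^+ 3 * k%:R) by ring.
  apply: le_trans (ler_wpM2r _ hA6) _; first by rewrite exprn_ge0.
  have -> : K ^+ 6 * k%:R ^+ 5 * L%:R ^+ 6 = k%:R ^+ 5 * (K ^+ 6 * L%:R ^+ 6) by ring.
  rewrite ler_wpM2l ?exprn_ge0//.
  apply: le_trans (ler_wpM2l _ (hq k k0n)); last by rewrite exprn_ge0// ltW.
  rewrite -/L [L%:R ^+ 7]exprS [leRHS](_ : _ = th ^+ 3 * q * L%:R * L%:R ^+ 6);
    last by ring.
  rewrite ler_wpM2r ?exprn_ge0//.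
  by move: rL; rewrite /r ler_pdivrMr ?mulr_gt0 ?exprn_gt0// mulrC.
have half1 : (k`! * ('C((N %/ (8 * L)).+1, k) * (8 * L) ^ k))%:R
    <= d / 2 * k`!%:R ^+ 2.
  apply: le_trans (rainbow_bound _ N0 hN _ hk kc) _; [by rewrite muln_gt0| |].
    (* [2 * 8L <= 16k <= k^2]. *)
    by clear -k16 Lk; nia.
  rewrite eA mulrAC ler_wpM2r ?exprn_ge0//.
  have eL : expR (- ((8 * L)%:R / 4)) <= 4 / k%:R ^+ 2 :> R.
    rewrite expRN -[leRHS]invrK lef_pV2 ?posrE ?expR_gt0 ?invr_gt0 ?divr_gt0
      ?exprn_gt0//.
    have -> : (8 * L)%:R / 4 = 1 * (2 * L)%:R :> R by rewrite !natrM; field.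
    rewrite expRM_natr invf_div ler_pdivrMr//.
    have e2 : 2 <= expR 1 :> R by apply: le_trans (expR_ge1Dx 1); lra.
    have : 2 ^+ (2 * L) <= expR 1 ^+ (2 * L) :> R.
      by apply: lerXn2r; rewrite ?nnegrE ?expR_ge0.
    move/(ler_wpM2r (ler0n R 4)); apply: le_trans.
    rewrite -!natrX -natrM ler_nat.
    have /ltnW := trunc_log_ltn k (isT : (1 < 2)%N); rewrite -/L expnS => h.
    have -> : (2 ^ (2 * L) = (2 ^ L) ^ 2)%N by rewrite mulnC expnM.
    by move: h; clear; move: (2 ^ L)%N => x; nia.
  apply: le_trans (ler_pM A0 (expR_ge0 _) AK eL) _.
  rewrite [leLHS](_ : _ = 4 * K / k%:R); last by field; rewrite gt_eqF.
  rewrite ler_pdivrMr//; move: kK; rewrite ler_pdivrMr//; lra.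
have half2 : ('C(N, k) * ((8 * L) ^ 2 * 'C(N.-2, k.-2)))%:R
    <= d / 2 * k`!%:R ^+ 2 :> R.
  rewrite mulnCA natrM natrX.
  apply: le_trans (ler_wpM2l _ hbin) _; first by rewrite exprn_ge0.
  rewrite mulrA ler_wpM2r ?exprn_ge0//.
  rewrite [leLHS](_ : _ = 64 * c ^+ 2 * (A ^+ 2 * L%:R ^+ 2) / k%:R ^+ 2).
    2: by rewrite natrM; field; rewrite gt_eqF.
  rewrite ler_pdivrMr ?exprn_gt0//.
  have c64 : 0 <= 64 * c ^+ 2 by rewrite mulr_ge0 ?sqr_ge0.
  apply: le_trans (ler_wpM2l c64 AL) _; rewrite mulrA ler_wpM2r ?exprn_ge0//.
  lra.
rewrite natrD; apply: le_trans (lerD half1 half2) _.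
by rewrite -mulrDl -splitr.
Unshelve. all: by end_near. Qed.

(** Since [e <= (e^2/2)^2], the right side is at least [e^k]. This growth absorbs the factor [k^3]
    in [asymptotic_size]. *)
Lemma half_expR1_sqr_expn_ge (k : nat) :
  (k%:R / 4) ^+ 4 <= (expR 1 ^+ 2 / 2) ^+ (2 * k) :> R.
Proof.
apply: le_trans (expR_ge_expn (isT : (0 < 4)%N) (ler0n R k)) _.
rewrite -[k%:R]mulr1 expRM_natl exprM; apply: lerXn2r.
- by rewrite nnegrE expR_ge0.
- by rewrite nnegrE sqr_ge0.
have : 2 <= expR 1 :> R by apply: le_trans (expR_ge1Dx 1); lra.
move: (expR 1) => e e2; have : 8 <= e ^+ 3 by nra.
by move: e2; nra.
Qed.

(** Write [n k = P (k/e)^2]. The first two bounds say [P <= e^2/2] and [1 <= P]; all are read off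
    from [P^(2k) = X^2 k^3], which has natural exponents only. *)
Lemma asymptotic_size (C : R) (eps : nat -> R) (n : nat -> nat) :
  0 < C -> eps @ \oo --> 0 ->
  (forall k : nat, (2 <= k)%N ->
    (n k)%:R = (C * (1 + eps k)) `^ (1 / k%:R) * (k%:R / expR 1) ^+ 2
               * k%:R `^ (3 / (2 * k%:R))) ->
  \forall k \near \oo,
    [/\ (2 * n k <= k ^ 2)%N, k%:R ^+ 2 <= expR 1 ^+ 2 * (n k)%:R :> R &
      (n k)%:R ^+ (2 * k) * expR 1 ^+ (4 * k)
        <= (2 * C) ^+ 2 * k%:R ^+ (4 * k + 3)].
Proof.
move=> C0 eps0 hn; near=> k.
have k2 : (2 <= k)%N by near: k; exact: nbhs_infty_ge.
have kC : 2 / C <= k%:R by near: k; exact: nbhs_infty_ger.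
(* Gives [(2C)^2 k^3 <= (k/4)^4], used for the upper bound on [P]. *)
have kCC : (2 * C) ^+ 2 * 4 ^+ 4 <= k%:R by near: k; exact: nbhs_infty_ger.
have e1 : eps k <= 1 by near: k; apply: (cvgr_le 0) => //; exact: ltr01.
have e2 : - (1 / 2) <= eps k.
  by near: k; apply: (cvgr_ge 0) => //; rewrite oppr_lt0 divr_gt0.
have k0n : (0 < k)%N by exact: ltnW.
have k0 : 0 < k%:R :> R by rewrite ltr0n.
have e0 : 0 < expR 1 :> R := expR_gt0 1.
set X := C * (1 + eps k).
have Xl : C / 2 <= X by rewrite /X; nra.
have Xu : X <= 2 * C by rewrite /X; nra.
have X0 : 0 <= X by apply: le_trans Xl; rewrite divr_ge0 ?ltW.
pose P := X `^ (1 / k%:R) * k%:R `^ (3 / (2 * k%:R)).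
have P0 : 0 <= P by rewrite mulr_ge0 ?powR_ge0.
have nP : (n k)%:R = P * (k%:R / expR 1) ^+ 2 by rewrite hn// /P mulrAC.
have P2k : P ^+ (2 * k) = X ^+ 2 * k%:R ^+ 3.
  rewrite exprMn -!powR_mulrn ?powR_ge0// -!powRrM !natrM.
  congr (_ `^ _ * _ `^ _); field; by rewrite gt_eqF.
have Xk : X ^+ 2 * k%:R ^+ 3 <= (2 * C) ^+ 2 * k%:R ^+ 3.
  by rewrite ler_wpM2r ?exprn_ge0// ?lerXn2r ?nnegrE// mulr_ge0 ?ltW.
clearbody P.
have P1 : 1 <= P.
  rewrite -(@expr_ge1 _ (2 * k)) ?muln_gt0// P2k.
  have Xk1 : 1 <= X * k%:R.
    move: kC; rewrite ler_pdivrMr// => kC; nra.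
  have -> : X ^+ 2 * k%:R ^+ 3 = (X * k%:R) ^+ 2 * k%:R by ring.
  have k1 : 1 <= k%:R :> R by rewrite ler1n.
  by rewrite -[leLHS]mulr1 ler_pM// exprn_ege1.
have Pu : P <= expR 1 ^+ 2 / 2.
  have q0 : 0 <= expR 1 ^+ 2 / 2 :> R by rewrite divr_ge0 ?sqr_ge0.
  rewrite -(@ler_pXn2r _ (2 * k)) ?muln_gt0 ?nnegrE// P2k.
  apply: le_trans (half_expR1_sqr_expn_ge k); apply: le_trans Xk _.
  have -> : (k%:R / 4) ^+ 4 = k%:R / 4 ^+ 4 * k%:R ^+ 3 :> R by field.
  by apply: ler_wpM2r; rewrite ?exprn_ge0 ?ler_pdivlMr ?exprn_gt0.
split.
- rewrite -(ler_nat R) natrM natrX nP expr_div_n mulrA mulrA.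
  rewrite ler_pdivrMr ?exprn_gt0// mulrC ler_wpM2l ?sqr_ge0//; lra.
- rewrite nP [leRHS](_ : _ = P * k%:R ^+ 2); first by rewrite ler_peMl// sqr_ge0.
  by field; rewrite gt_eqF.
- have -> : (4 * k = 2 * (2 * k))%N by rewrite mulnA.
  rewrite nP exprMn P2k -exprM expr_div_n -mulrA divfK; last first.
    by rewrite expf_neq0// gt_eqF.
  by rewrite addnC exprD mulrA ler_wpM2r ?exprn_ge0.
Unshelve. all: by end_near. Qed.

End Estimates.

(** * Conclusion with blocks of consecutive integers *)

Local Open Scope classical_set_scope.
Local Open Scope ring_scope.

Theorem theorem2 (R : realType) (alpha : R) (n : nat -> nat)
    (halpha : 0 < alpha < 1)
    (hpos : forall k : nat, (2 <= k)%N -> (0 < n k)%N)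
    (hn : exists2 eps : nat -> R, eps @ \oo --> 0 &
      forall k : nat, (2 <= k)%N ->
        (n k)%:R = (constO R * alpha * (1 + eps k)) `^ (1 / k%:R)
                   * (k%:R / expR 1) ^+ 2
                   * k%:R `^ (3 / (2 * k%:R))) :
  \forall k \near \oo,
    (1 - alpha) * #|ktournaments (n k) k|%:R
      <= #|[set E in ktournaments (n k) k | ~~ `[< propertyO E >]]%SET|%:R.
Proof.
have /andP[a0 _] := halpha; have [eps eps0 hnk] := hn.
have C0 : 0 < constO R * alpha.
  by rewrite mulr_gt0// divr_gt0 ?expR_gt0// mulr_gt0 ?pi_gt0.
have K0 : 0 < 2 * (constO R * alpha) by rewrite mulr_gt0.
have size_n := asymptotic_size C0 eps0 hnk.
have small := bad_weight_small K0 (sqr_ge0 (expR 1)) a0.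
near=> k.
have n0 : (0 < n k)%N by apply: hpos; near: k; exact: nbhs_infty_ge.
have [nk1 nk2 nk3] : [/\ (2 * n k <= k ^ 2)%N,
    k%:R ^+ 2 <= expR 1 ^+ 2 * (n k)%:R :> R &
    (n k)%:R ^+ (2 * k) * expR 1 ^+ (4 * k)
      <= (2 * (constO R * alpha)) ^+ 2 * k%:R ^+ (4 * k + 3)].
  by near: k.
have [m [b [nmb weight]]] : exists m b : nat, (n k <= m * b)%N /\
    (k`! * ('C(m, k) * b ^ k) + 'C(n k, k) * (b ^ 2 * 'C((n k).-2, k.-2)))%:R
      <= alpha * k`!%:R ^+ 2.
  (* [bad_weight_small] is uniform in [N], so [n k] can be generalized before passing to large
     [k]. *)
  by move: (n k) n0 nk1 nk2 nk3; near: k.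
have b0 : (0 < b)%N by case: b nmb {weight} => //; rewrite muln0 leqNgt n0.
have fP (i : 'I_(n k)) : (i %/ b < m)%N.
  by rewrite ltn_divLR// (leq_trans (ltn_ord i)).
(* Quotient and remainder by [b] cut the vertices into blocks of consecutive integers. *)
pose f (i : 'I_(n k)) := Ordinal (fP i).
pose g (i : 'I_(n k)) := Ordinal (ltn_pmod i b0).
have fg_inj : injective (fun i => (f i, g i)).
  move=> i j [fij gij]; apply: val_inj.
  by rewrite /= (divn_eq i b) (divn_eq j b) fij gij.
have := card_propertyO k fg_inj; rewrite card_ord -/(ktournaments (n k) k).
set P := #|_|; set T := #|_| => PT.
have PaT : P%:R <= alpha * T%:R :> R.
  have F0 : 0 < k`!%:R ^+ 2 :> R by rewrite exprn_gt0// ltr0n fact_gt0.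
  rewrite -(ler_pM2r F0) [alpha * _]mulrC -mulrA.
  apply: le_trans (ler_wpM2l (ler0n R T) weight).
  by rewrite -natrX -!natrM ler_nat.
(* Pass to the complement of the tournaments with Property O, of which there are at most
   [alpha * T]. *)
have -> : #|[set E in ktournaments (n k) k | ~~ `[< propertyO E >]]%SET| = (T - P)%N.
  rewrite /T -(cardsID [set E | `[< propertyO E >]]%SET) addnC.
  rewrite -[X in (_ + X - _)%N](_ : P = _) ?addnK.
    by apply: eq_card => E; rewrite !inE andbC.
  by apply: eq_card => E; rewrite !inE.
rewrite natrB; first by rewrite mulrBl mul1r lerD2l lerN2.
by apply/subset_leq_card/fintype.subsetP => E; rewrite !inE => /andP[].
Unshelve. all: by end_near. Qed.
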